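(* If $\psi\colon\mathbb{F}_{q^2}\to\overline{\mathbb{Q}}_\ell^\times$ is an additive character of conductor $q^2$, then there exists a bijection between $\mathcal A_\psi$ and $\mathcal G_\psi$. Furthermore, every representation in $\mathcal G_\psi$ has dimension $q^{h-1}$.
   Context: Let $p$ be a prime, $q$ a power of $p$, $\ell\ne p$ a prime, and $h\ge2$ an integer. For a commutative $\mathbb{F}_q$-algebra $A$, let $U_h^{2,q}(A)$ be the set of formal expressions $1+\sum_{i=1}^{2(h-1)}a_i\tau^i$ ($a_i\in A$) with multiplication obtained by extending $(a\tau^i)(b\tau^j)=ab^{q^i}\tau^{i+j}$ bi-additively, where $\tau^0=1$ and $\tau^k=0$ for $k>2(h-1)$. Put $\mathcal U=U_h^{2,q}(\mathbb{F}_{q^2})$, $H=\{1+\sum a_i\tau^i\in\mathcal U: a_i=0\text{ for odd } i\}$ and $H_{2(h-1)}=\{1+a\tau^{2(h-1)}: a\in\mathbb{F}_{q^2}\}$. Let $L=\mathbb{F}_{q^2}((\pi))$ and $U_L^i=1+\pi^i\mathbb{F}_{q^2}[[\pi]]$. An additive character $\psi$ of $\mathbb{F}_{q^2}$ has conductor $q^2$ if there exists $x$ with $\psi(x^q)\ne\psi(x)$. $\mathcal A_\psi$ is the set of characters $\chi\colon U_L^1/U_L^h\to\overline{\mathbb{Q}}_\ell^\times$ with $\chi(1+a\pi^{h-1})=\psi(a)$ for all $a\in\mathbb{F}_{q^2}$. $\mathcal G_\psi$ is the set of (isomorphism classes of) irreducible representations of $\mathcal U$ in which each $1+a\tau^{2(h-1)}\in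 H_{2(h-1)}$ acts by the scalar $\psi(a)$. *)

(* Defs.v *)
From HB Require Import structures.
From mathcomp Require Import all_boot all_order all_algebra all_fingroup.
From mathcomp Require Import mxrepresentation.
Set Implicit Arguments.
Unset Strict Implicit.
Unset Printing Implicit Defensive.
Import GRing.Theory.
Local Open Scope ring_scope.

(* Truncated (twisted) unipotent power series  1 + sum_{i=1}^N a_i t^i  over a
   finite field K, with the twisted rule (a t^i)(b t^j) = a b^(q^i) t^(i+j)
   and t^k = 0 for k > N.  An element is encoded by its coefficient vector
   y : {ffun 'I_N -> K}  (y i is the coefficient a_(i+1)).
   q = 1 gives the ordinary (untwisted) truncated power series. *)
Section Twisted.
Variables (K : finFieldType) (q N : nat).

Definition tcoef (y : {ffun 'I_N -> K}) (i : nat) : K :=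
  if i is j.+1 then oapp (fun k => y k) 0 (insub j) else 1.

Definition tw_mul (x y : {ffun 'I_N -> K}) : {ffun 'I_N -> K} :=
  [ffun k : 'I_N => \sum_(i < k.+2) tcoef x i * tcoef y (k.+1 - i) ^+ (q ^ i)].

(* matrix of right multiplication by y on the left K-space with basis
   1, t, ..., t^N  (row vectors):  (c t^j) * (b t^i) = c b^(q^j) t^(i+j) *)
Definition tw_mx (y : {ffun 'I_N -> K}) : 'M[K]_N.+1 :=
  \matrix_(j, k) if (j <= k)%N then tcoef y (k - j) ^+ (q ^ j) else 0.

Definition tw_set : {set {'GL_N.+1[K]}} :=
  [set g : {'GL_N.+1[K]} | [exists y, GLval g == tw_mx y]].

(* the group they form (see gen_tw_set below: <<tw_set>> = tw_set) *)
Definition tw_group : {group {'GL_N.+1[K]}} := <<tw_set>>%G.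

Definition top_elt (a : K) : {ffun 'I_N -> K} :=
  [ffun i : 'I_N => if i.+1 == N then a else 0].

End Twisted.

Definition Ucal (K : finFieldType) (q h : nat) := tw_group K q (2 * (h - 1)).

(* U_L^1 / U_L^h : truncated series 1 + a_1 pi + ... + a_{h-1} pi^{h-1} mod pi^h *)
Definition UL (K : finFieldType) (h : nat) := tw_group K 1 (h - 1).

Definition additive_character (K : finFieldType) (F : fieldType) (psi : K -> F) :=
  (forall a b, psi (a + b) = psi a * psi b) /\ (forall a, psi a != 0).

Definition conductor_q2 (K : finFieldType) (F : fieldType) (q : nat) (psi : K -> F) :=
  exists x : K, psi (x ^+ q) != psi x.

Definition A_psi (K : finFieldType) (F : fieldType) (h : nat) (psi : K -> F)
    (chi : {'GL_(h - 1).+1[K]} -> F) : Prop :=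
  [/\ {in UL K h &, forall g1 g2, chi (g1 * g2)%g = chi g1 * chi g2},
      {in UL K h, forall g, chi g != 0} &
      forall (a : K) g, g \in UL K h -> GLval g = tw_mx 1 (top_elt (h - 1) a) ->
        chi g = psi a].

Definition G_psi (K : finFieldType) (F : fieldType) (q h : nat) (psi : K -> F)
    n (rG : mx_representation F (Ucal K q h) n) : Prop :=
  mx_irreducible rG /\
  forall (a : K) g, g \in Ucal K q h ->
    GLval g = tw_mx q (top_elt (2 * (h - 1)) a) -> rG g = (psi a)%:M.
Arguments A_psi {K F} h psi chi.

(* Main.v *)
Require Import Defs.
From mathcomp Require Import all_boot all_order all_algebra all_fingroup.
From mathcomp Require Import all_solvable mxrepresentation finfield zify.
Set Implicit Arguments.
Unset Strict Implicit.
Unset Printing Implicit Defensive.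
Import GRing.Theory GroupScope.
Local Open Scope ring_scope.

(* Put m = h - 1.  For any central subgroup Z and character psi of Z, the squares of the
   degrees of the irreducible representations over psi add up to the index of Z.  Hence, once
   every representation in G_psi is known to have degree q^m, both G_psi and A_psi have
   q^(2m - 2) elements, and any bijection will do.

   For the degree, let [pol] consist of the elements whose odd coefficients vanish below m,
   the m-th one being in F_q if m is odd, and let [iso] consist of the elements of [pol] whose
   even coefficients vanish below 2m.  If the lowest nonzero coefficient of a has odd index,
   then a is conjugate to a times a central element on which psi is nontrivial, so a has
   trace 0.  On [iso] the trace is therefore supported on the centre, and the degree is at
   least [iso : Z] = q^m.  Applied to a subgroup of [iso] containing the commutators of [pol],
   it also yields a vector fixed by these commutators, hence an eigenvector of [pol], whose
   translates span the representation: the degree is at most [U : pol] = q^m. *)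

(** * Representations in characteristic zero *)

Section Representations.

Variables (F : closedFieldType) (gT : finGroupType).
Hypothesis charF0 : [pchar F] =i pred0.
Implicit Types (G H O A Z : {group gT}).

Lemma pchar0_eqr_nat m n : (m%:R == n%:R :> F) = (m == n).
Proof.
wlog le_mn : m n / (m <= n)%N => [IH|].
  by case/orP: (leq_total m n) => /IH //; rewrite eq_sym => ->; rewrite eq_sym.
rewrite eq_sym -subr_eq0 -natrB //.
by have /pcharf0P -> := charF0; rewrite subn_eq0 eqn_leq le_mn.
Qed.

Lemma pchar0_pgroup G : [pchar F]^'.-group G.
Proof. by apply/pgroupP => p _ _; change (p \notin [pchar F]); rewrite charF0. Qed.

Lemma sum_mul_char Z (f : gT -> F) :
    {in Z &, forall x y, f (x * y)%g = f x * f y} ->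
  (exists2 x, x \in Z & f x != 1) -> \sum_(x in Z) f x = 0.
Proof.
move=> fM [x Zx fx1]; apply/eqP.
have: f x * (\sum_(y in Z) f y) = \sum_(y in Z) f y.
  rewrite mulr_sumr [RHS](reindex_inj (mulgI x)) /=.
  by apply: eq_big => y => [|Zy]; rewrite ?groupMl ?fM.
move/eqP; rewrite -subr_eq0 -{2}[\sum_(y in Z) f y]mul1r -mulrBl mulf_eq0.
by rewrite subr_eq0 (negPf fx1).
Qed.

Lemma mxtrace_regular_repr G x : x \in G ->
  \tr (regular_repr F G x) = if x == 1%g then #|G|%:R else 0.
Proof.
move=> Gx; case: eqP => [-> | /eqP ntx]; first by rewrite repr_mx1 mxtrace1.
rewrite /mxtrace big1 // => i _; rewrite !mxE eqxx /=.
case: eqP => // /(congr1 (fun j => enum_val j)).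
rewrite gring_indexK ?groupM ?enum_valP // => /eqP.
by rewrite eq_sym -{2}[enum_val i]mulg1 (inj_eq (mulgI _)) (negPf ntx).
Qed.

(** Compute the sum over [Z] of [(psi z)^-1] times the regular character in two ways. Only [z = 1]
    contributes directly, which gives [#|G|]. In the decomposition into irreducibles, [Z] acts on
    component [i] by the scalar character [irr_mode i], and orthogonality leaves [#|Z|] times the
    squared degree when this is [psi], and 0 otherwise. *)
Lemma sum_irr_over G Z (psi : gT -> F) (sG : irrType F G) :
    Z \subset 'Z(G) -> {in Z &, forall x y, psi (x * y)%g = psi x * psi y} ->
    {in Z, forall z, psi z != 0} ->
  (\sum_(i : sG | [forall z in Z, irr_repr i z == (psi z)%:M])
      irr_degree i ^ 2 * #|Z| = #|G|)%N.
Proof.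
move=> sZ psiM psi0.
have splitG : group_splitting_field F G by apply: group_closure_closed_field.
have F'G := pchar0_pgroup G.
have psi1 : psi 1%g = 1.
  apply: (mulfI (psi0 _ (group1 Z))); rewrite mulr1 -psiM ?group1 //.
  by rewrite mulg1.
have ZG z : z \in Z -> z \in G by move/(subsetP sZ); case/setIP.
have sumR : \sum_(z in Z) (psi z)^-1 * \tr (regular_repr F G z) = #|G|%:R.
  rewrite (bigD1 1%g) ?group1 //= big1 ?addr0.
    by rewrite psi1 invr1 mul1r mxtrace_regular_repr ?group1 // eqxx.
  move=> z /andP[Zz z1]; rewrite mxtrace_regular_repr ?ZG //.
  by rewrite (negPf z1) mulr0.
apply/eqP; rewrite -pchar0_eqr_nat -sumR; apply/eqP.
transitivity (\sum_(z in Z) \sum_(i : sG)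
    (psi z)^-1 * ((irr_mode i z * (irr_degree i)%:R) *+ irr_degree i)).
  rewrite exchange_big /= natr_sum big_mkcond /=; apply: eq_bigr => i _.
  have modeM x y : x \in Z -> y \in Z ->
      irr_mode i (x * y)%g = irr_mode i x * irr_mode i y.
    by move=> Zx Zy; rewrite (irr_modeM splitG) // (subsetP sZ).
  rewrite [RHS](eq_bigr (fun z =>
      (psi z)^-1 * irr_mode i z * (irr_degree i ^ 2)%:R)); last first.
    by move=> z _; rewrite -mulrnAr -mulrnA mulrA mulnn.
  rewrite -mulr_suml; case: ifP => over.
    rewrite (eq_bigr (fun=> 1)); last first.
      move=> z Zz; move/forall_inP: over => /(_ z Zz)/eqP.
      rewrite (irr_center_scalar splitG) ?(subsetP sZ) //.
      move/matrixP/(_ (Ordinal (irr_degree_gt0 i)) (Ordinal (irr_degree_gt0 i))).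
      by rewrite !mxE eqxx !mulr1n => ->; rewrite mulVf ?psi0.
    by rewrite sumr_const natrM mulrC.
  rewrite sum_mul_char ?mul0r // => [x y Zx Zy|].
    by rewrite psiM // modeM // invfM mulrACA.
  move/negbT: over; rewrite negb_forall_in => /exists_inP[z Zz nz].
  exists z => //; apply: contraNneq nz => e.
  rewrite (irr_center_scalar splitG) ?(subsetP sZ) //.
  by rewrite -[irr_mode i z]mul1r -(mulfV (psi0 _ Zz)) -mulrA e mulr1.
apply: eq_bigr => z Zz.
rewrite (mxtrace_regular_pchar sG F'G splitG) ?ZG // mulr_sumr.
apply: eq_bigr => i _.
have -> : socle_repr i z = irr_repr i z by [].
rewrite (irr_center_scalar splitG) ?(subsetP sZ) //.
by rewrite mxtrace_scalar mulr_natr.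
Qed.

(** With the rank factorization [P = C *m R], idempotence forces [R *m C = 1], an identity matrix of
    size [\rank P] with the same trace as [P]. *)
Lemma mxtrace_idempotent n (P : 'M[F]_n) : P *m P = P -> \tr P = (\rank P)%:R.
Proof.
move=> PP; rewrite -{1}(mulmx_base P) mxtrace_mulC.
suff -> : row_base P *m col_base P = 1%:M by rewrite mxtrace1.
apply: (row_free_inj (row_base_free P)); rewrite mul1mx.
apply: (row_full_inj (col_base_full P)).
rewrite -(mulmxA (row_base P)) (mulmxA (col_base P) (row_base P)).
by rewrite mulmx_base PP.
Qed.


Lemma der1_eigenvector G H O n (rG : mx_representation F G n) :
    H \subset G -> O \subset H -> H^`(1)%g \subset O ->
    \sum_(u in O) \tr (rG u) != 0 ->
  exists2 v : 'rV_n, v != 0 & {in H, forall g, (v *m rG g <= v)%MS}.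
Proof.
move=> sHG sOH sH'O; pose E := \sum_(u in O) rG u.
rewrite -[\sum_(u in O) _](raddf_sum (@mxtrace F n)) => trE.
have sOG := subset_trans sOH sHG.
have nzE : E != 0 by apply: contraNneq trE => E0; rewrite -/E E0 raddf0.
have EO u : u \in O -> E *m rG u = E.
  move=> Ou; rewrite mulmx_suml [RHS](reindex_inj (mulIg u)) /=.
  apply: eq_big => x; first by rewrite groupMr.
  by move=> Ox; rewrite repr_mxM ?(subsetP sOG).
pose rH := subg_repr rG sHG.
have nOH : H \subset 'N(O) by rewrite normal_norm // sub_der1_normal.
have modE : mxmodule rH E.
  apply/mxmoduleP => x Hx; have Gx := subsetP sHG x Hx.
  suff -> : E *m rH x = rG x *m E by apply: submxMl.
  rewrite mulmx_suml mulmx_sumr [RHS](reindex_inj (conjg_inj x)) /=.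
  apply: eq_big => u; first by rewrite memJ_norm ?(subsetP nOH).
  move=> Ou; have Gu := subsetP sOG u Ou.
  by rewrite -!repr_mxM ?groupJ // -conjgC.
have [W simW sWE] := dec_mxsimple_exists modE nzE.
have [modW nzW _] := simW.
have rW : \rank W = 1%N.
  have /(submod_mx_irr modW) irrW := simW.
  have splitH : group_splitting_field F H by apply: group_closure_closed_field.
  apply/eqP; rewrite -(der1_sub_rker splitH irrW) rker_submod.
  apply: subset_trans sH'O _; apply/subsetP => u Ou.
  rewrite inE (subsetP sOH) //=; have /submxP[X ->] := sWE.
  by rewrite -mulmxA EO.
exists (nz_row W); first by rewrite nz_row_eq0.
move=> g Hg; have sW : (W <= nz_row W)%MS.
  by rewrite -(mxrank_leqif_sup (nz_row_sub W)).2 rW rank_rV nz_row_eq0 nzW.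
apply: submx_trans sW; apply: submx_trans (mxmoduleP modW g Hg).
exact: submxMr (nz_row_sub W).
Qed.

(** Up to scalars, [v *m rG g] depends only on the coset [H :* g]. One line for each coset therefore
    spans a submodule, which is the whole space by irreducibility. *)
Lemma irr_eigenvector_dim G H n (rG : mx_representation F G n) (v : 'rV_n) :
    mx_irreducible rG -> H \subset G -> v != 0 ->
    {in H, forall g, (v *m rG g <= v)%MS} -> (n <= #|G : H|)%N.
Proof.
case/mx_irrP=> _ irrG sHG nzv vH.
pose W := (\sum_(C in rcosets H G) <<v *m rG (repr C)>>)%MS.
have vW g : g \in G -> (v *m rG g <= W)%MS.
  move=> Gg; have HgG : H :* g \in rcosets H G by apply/rcosetsP; exists g.
  apply: (submx_trans _ (sumsmx_sup _ HgG (submx_refl _))).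
  rewrite genmxE; have /rcosetP[x Hx rE] := mem_repr_rcoset H g.
  have {1}-> : g = (x^-1 * repr (H :* g))%g by rewrite rE mulKg.
  have GV : x^-1%g \in G by rewrite groupV (subsetP sHG).
  have GR : repr (H :* g) \in G by rewrite rE groupM ?(subsetP sHG x).
  by rewrite repr_mxM // mulmxA submxMr ?vH ?groupV.
have modW : mxmodule rG W.
  apply/mxmoduleP => x Gx; rewrite sumsmxMr; apply/sumsmx_subP => C.
  case/rcosetsP=> g Gg ->; rewrite (eqmxMr _ (genmxE _)) -mulmxA.
  have Gr : repr (H :* g) \in G.
    by have /rcosetP[y Hy ->] := mem_repr_rcoset H g; rewrite groupM ?(subsetP sHG y).
  by rewrite -repr_mxM // vW ?groupM.
have nzW : W != 0.
  apply: contraNneq nzv => W0; have := vW 1%g (group1 G).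
  by rewrite W0 repr_mx1 mulmx1 submx0.
have /eqP <- := irrG W modW nzW.
apply: (leq_trans (mxrank_sum_leqif _).1) => /=.
rewrite /indexg -sum1_card; apply: leq_sum => C _; rewrite genmxE; exact: rank_leq_row.
Qed.

(** Let [th] be the character by which [A] acts on [v]. The average [Q] of [(th a)^-1 *: rG a] is
    idempotent and fixes [v], so its trace is a positive integer; since only [Z] contributes to it,
    this trace times [#|A|] is [#|Z| * n]. *)
Lemma eigenvector_dim_ge G A Z n (rG : mx_representation F G n) (v : 'rV_n) :
    A \subset G -> Z \subset A -> v != 0 ->
    {in A, forall g, (v *m rG g <= v)%MS} ->
    {in Z, forall z, is_scalar_mx (rG z)} ->
    {in A :\: Z, forall a, \tr (rG a) = 0} ->
  (#|A| <= #|Z| * n)%N.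
Proof.
move=> sAG sZA nzv vA scZ trA.
have [j vj] : exists j, v 0 j != 0 by apply/rV0Pn.
pose th a := (v *m rG a) 0 j / v 0 j.
have vth a : a \in A -> v *m rG a = th a *: v.
  case/vA/sub_rVP=> c ec; rewrite ec; congr (_ *: _).
  by rewrite /th ec mxE mulfK.
clearbody th.
have v_inj (a b : F) : a *: v = b *: v -> a = b.
  by move/rowP/(_ j); rewrite !mxE => /(mulIf vj).
have AG a : a \in A -> a \in G by move/(subsetP sAG).
have thM : {in A &, forall a b, th (a * b)%g = th a * th b}.
  move=> a b Aa Ab; apply: v_inj; rewrite -vth ?groupM // repr_mxM ?AG //.
  by rewrite mulmxA vth // -scalemxAl vth // scalerA.
have th1 : th 1%g = 1.
  by apply: v_inj; rewrite -vth ?group1 // repr_mx1 mulmx1 scale1r.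
have th0 a : a \in A -> th a != 0.
  move=> Aa; apply/eqP => th_a0; have := thM a a^-1%g Aa (groupVr Aa).
  by move/eqP; rewrite mulgV th1 th_a0 mul0r oner_eq0.
pose P := \sum_(a in A) (th a)^-1 *: rG a.
have PA b : b \in A -> P *m rG b = th b *: P.
  move=> Ab; rewrite mulmx_suml scaler_sumr.
  rewrite [RHS](reindex_inj (mulIg b)) /=.
  apply: eq_big => x; first by rewrite groupMr.
  move=> Ax; rewrite -scalemxAl repr_mxM ?AG // thM // scalerA.
  by rewrite invfM mulrCA mulfV ?mulr1 ?th0.
pose A1 : F := #|A|%:R.
have nzA : A1 != 0.
  by rewrite -[0]/(0%:R) pchar0_eqr_nat -lt0n cardG_gt0.
pose Q := A1^-1 *: P.
have QQ : Q *m Q = Q.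
  rewrite -scalemxAl -scalemxAr scalerA {2}/P mulmx_sumr.
  rewrite (eq_bigr (fun=> P)); last first.
    by move=> a Aa; rewrite -scalemxAr PA // scalerA mulVf ?th0 ?scale1r.
  by rewrite sumr_const -scaler_nat scalerA -mulrA mulVf ?mulr1.
have vQ : v *m Q = v.
  rewrite -scalemxAr mulmx_sumr (eq_bigr (fun=> v)); last first.
    by move=> a Aa; rewrite -scalemxAr vth // scalerA mulVf ?th0 ?scale1r.
  by rewrite sumr_const -scaler_nat scalerA mulVf ?scale1r.
have rQ : (0 < \rank Q)%N.
  rewrite lt0n mxrank_eq0; apply: contraNneq nzv => Q0.
  by rewrite -vQ Q0 mulmx0.
have trQ : A1 * \tr Q = (#|Z| * n)%:R.
  rewrite mxtraceZ mulrA mulfV // mul1r linear_sum /=.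
  rewrite (big_setID Z) /= (setIidPr sZA) [X in _ + X]big1 ?addr0.
    rewrite (eq_bigr (fun=> n%:R)) ?sumr_const ?natrM ?mulr_natl //.
    move=> z Zz; have Az := subsetP sZA z Zz.
    have /is_scalar_mxP[c ec] := scZ z Zz.
    (* The scalar by which [z] acts is read off on [v], so it is [th z] and cancels the weight. *)
    have := vth z Az; rewrite ec mul_mx_scalar => /v_inj cE.
    by rewrite scale_scalar_mx {1}cE mulVf ?th0 ?mxtrace1.
  by move=> a /trA tr0; rewrite mxtraceZ tr0 mulr0.
move: trQ; rewrite mxtrace_idempotent // -natrM => /eqP.
by rewrite pchar0_eqr_nat // => /eqP <-; rewrite leq_pmulr.
Qed.

End Representations.

(** * The twisted groups in coordinates *)

Section TwistedGroup.

Variables (K : finFieldType) (q N : nat).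
(** In this form the section covers both [Ucal], where the q-th power is a Frobenius map, and [UL],
    where q = 1. *)
Hypothesis qD : forall x y : K, (x + y) ^+ q = x ^+ q + y ^+ q.
Hypothesis q_gt0 : (0 < q)%N.

Local Notation GL := {'GL_N.+1[K]}.
Local Notation G := (tw_group K q N).
Implicit Types (x y : {ffun 'I_N -> K}) (g h : GL) (S : nat -> {set K}).

(* The first row of the matrix of a series lists its coefficients. *)
Definition twcoefs g : {ffun 'I_N -> K} :=
  [ffun k => GLval g ord0 (lift ord0 k)].

Definition twcoef g : nat -> K := tcoef (twcoefs g).

(** [S] is indexed by the exponent of t, one more than the index in the coefficient vector. All
    subgroups below have this shape, so their orders are products. *)
Definition twfam S : {set GL} :=
  [set g in G | [forall i : 'I_N, twcoef g i.+1 \in S i.+1]].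

Lemma exprqD n (a b : K) : (a + b) ^+ (q ^ n) = a ^+ (q ^ n) + b ^+ (q ^ n).
Proof. by elim: n => // n IHn; rewrite expnSr !exprM IHn qD. Qed.

Lemma exprq0 n : 0 ^+ (q ^ n) = 0 :> K.
Proof. by rewrite expr0n expn_eq0 -leqn0 leqNgt q_gt0. Qed.

Lemma exprq_sum n (I : finType) (f : I -> K) :
  (\sum_i f i) ^+ (q ^ n) = \sum_i f i ^+ (q ^ n).
Proof. exact: (big_morph _ (exprqD n) (exprq0 n)). Qed.

Lemma tcoef_ord y (k : 'I_N) : tcoef y k.+1 = y k.
Proof. by rewrite /tcoef valK. Qed.

Lemma tcoef_gt y k : (N < k)%N -> tcoef y k = 0.
Proof. by case: k => //= k; rewrite ltnS => Nk; rewrite insubF // ltnNge Nk. Qed.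

Lemma tcoef_zero k : tcoef (0 : {ffun 'I_N -> K}) k.+1 = 0.
Proof. by rewrite /tcoef; case: insub => //= i; rewrite ffunE. Qed.

Lemma tcoef_mul x y k : (k <= N)%N ->
  tcoef (tw_mul q x y) k = \sum_(i < k.+1) tcoef x i * tcoef y (k - i) ^+ (q ^ i).
Proof.
case: k => [|k] lekN; first by rewrite big_ord1 /= mul1r expr1n.
by rewrite (tcoef_ord _ (Ordinal lekN)) ffunE.
Qed.

Lemma tw_mxM x y : tw_mx q x *m tw_mx q y = tw_mx q (tw_mul q x y).
Proof.
apply/matrixP => j k; rewrite !mxE; case: leqP => [le_jk | lt_kj]; last first.
  rewrite big1 // => l _; rewrite !mxE; case: leqP => jl; last by rewrite mul0r.
  by rewrite leqNgt (leq_trans lt_kj jl) mulr0.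
have kN : (k - j <= N)%N by rewrite (leq_trans (leq_subr _ _)) // -ltnS.
rewrite tcoef_mul // exprq_sum.
pose F i := (tcoef x i * tcoef y (k - j - i) ^+ (q ^ i)) ^+ (q ^ j).
(* Extended by zero outside [j <= l <= k], the summand can be cut at both ends of the full range and
   then shifted by [j]. *)
pose f l := if (j <= l <= k)%N then F (l - j)%N else 0.
transitivity (\sum_(0 <= l < N.+1) f l).
  rewrite big_mkord; apply: eq_bigr => l _; rewrite !mxE /f /F.
  case: leqP => jl /=; last by rewrite mul0r.
  case: leqP => lk /=; last by rewrite mulr0.
  by rewrite exprMn -exprM -expnD subnK // -subnDA subnKC.
rewrite (@big_cat_nat _ _ _ j) //=; last by rewrite ltnW // ltn_ord.
rewrite big_nat_cond big1 ?add0r => [|l]; last first.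
  by rewrite andbT => /andP[_ lj]; rewrite /f leqNgt lj.
rewrite (@big_cat_nat _ _ _ k.+1) //=; last exact: leqW.
rewrite [X in _ + X]big_nat_cond [X in _ + X]big1 ?addr0 => [|l]; last first.
  by rewrite andbT => /andP[kl _]; rewrite /f andbC leqNgt kl.
rewrite -{1}[val j]add0n big_addn subSn // big_mkord; apply: eq_bigr => l _.
rewrite /f leq_addl addnK /=; case: leqP => // kl.
by have := ltn_ord l; rewrite ltnS leq_subRL // addnC leqNgt kl.
Qed.

Lemma tw_mx_unit y : tw_mx q y \in unitmx.
Proof.
rewrite -unitmx_tr unitmxE det_trig.
  rewrite big1 ?unitr1 // => i _.
  by rewrite !mxE leqnn subnn /= expr1n.
by apply/is_trig_mxP => i j ltij; rewrite !mxE leqNgt ltij.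
Qed.

(** The default 1 is never taken, because [tw_mx q y] is unitriangular. *)
Definition twelt y : GL := insubd (1%g : GL) (tw_mx q y).

Lemma tweltE y : GLval (twelt y) = tw_mx q y.
Proof. by rewrite /twelt; apply: insubdK; apply: tw_mx_unit. Qed.

Lemma tw_setP g : reflect (exists y, GLval g = tw_mx q y) (g \in tw_set K q N).
Proof.
by rewrite inE; apply: (iffP existsP) => -[y] => [/eqP|->]; exists y.
Qed.

Lemma tw_set_group_set : group_set (tw_set K q N).
Proof.
apply/group_setP; split=> [|g h].
  apply/tw_setP; exists 0; rewrite GL_1E; apply/matrixP => j k; rewrite !mxE.
  rewrite -val_eqE /=; case: ltngtP => //= [lt_jk | ->].
    by rewrite -(subnSK lt_jk) tcoef_zero exprq0.
  by rewrite subnn expr1n.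
case/tw_setP=> x ex /tw_setP[y ey]; apply/tw_setP; exists (tw_mul q x y).
by rewrite GL_ME ex ey -tw_mxM.
Qed.

Lemma mem_tw_group g : (g \in G) = (g \in tw_set K q N).
Proof. by rewrite /= -{2}[tw_set _ _ _](gen_set_id tw_set_group_set). Qed.

Lemma twcoefs_mx g y : GLval g = tw_mx q y -> twcoefs g = y.
Proof.
move=> e; apply/ffunP => k; rewrite ffunE e !mxE /= expr1.
exact: tcoef_ord.
Qed.

Lemma tw_mx_coefs g : g \in G -> GLval g = tw_mx q (twcoefs g).
Proof. by rewrite mem_tw_group => /tw_setP[y e]; rewrite (twcoefs_mx e). Qed.

Lemma mem_twelt y : twelt y \in G.
Proof. by rewrite mem_tw_group; apply/tw_setP; exists y; apply: tweltE. Qed.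

Lemma tweltK y : twcoefs (twelt y) = y.
Proof. exact/twcoefs_mx/tweltE. Qed.

Lemma twcoefsK : {in G, cancel twcoefs twelt}.
Proof. by move=> g /tw_mx_coefs e; apply: val_inj; rewrite /= -/(GLval _) tweltE. Qed.

Lemma twcoef0 g : twcoef g 0 = 1. Proof. by []. Qed.

Lemma twcoefM g h k : g \in G -> h \in G -> (k <= N)%N ->
  twcoef (g * h)%g k = \sum_(i < k.+1) twcoef g i * twcoef h (k - i) ^+ (q ^ i).
Proof.
move=> Gg Gh kN; rewrite /twcoef -tcoef_mul //; congr (tcoef _ k).
by apply: twcoefs_mx; rewrite GL_ME -tw_mxM -!tw_mx_coefs.
Qed.

Lemma twcoef1 k : (0 < k)%N -> twcoef 1%g k = 0.
Proof.
case: k => // k _; have [kN | Nk] := ltnP k N; last exact: tcoef_gt.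
rewrite /twcoef (tcoef_ord _ (Ordinal kN)) ffunE GL_1E mxE.
by [].
Qed.

Lemma twcoef_inj g h : g \in G -> h \in G ->
  (forall k, (0 < k <= N)%N -> twcoef g k = twcoef h k) -> g = h.
Proof.
move=> Gg Gh e; rewrite -(twcoefsK Gg) -(twcoefsK Gh); congr twelt.
by apply/ffunP => k; rewrite -!tcoef_ord; apply: (e k.+1); rewrite /= ltn_ord.
Qed.

Lemma twcoef_exists (f : nat -> K) :
  exists2 g, g \in G & forall k, (0 < k <= N)%N -> twcoef g k = f k.
Proof.
exists (twelt [ffun k : 'I_N => f k.+1]) => [|[|k] // kN]; first exact: mem_twelt.
by rewrite /twcoef tweltK (tcoef_ord _ (Ordinal kN)) ffunE.
Qed.

Lemma twfamP S g :
  reflect (g \in G /\ forall k, (0 < k <= N)%N -> twcoef g k \in S k)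
          (g \in twfam S).
Proof.
rewrite inE; apply: (iffP andP) => -[Gg Sg]; split=> //.
  by case=> // k kN; apply: (forallP Sg (Ordinal kN)).
by apply/forallP => k; apply: Sg; rewrite /= ltn_ord.
Qed.

Lemma card_twfam S : #|twfam S| = \prod_(i < N) #|S i.+1|.
Proof.
rewrite -(card_in_imset (f := twcoefs)); last first.
  by move=> g h /twfamP[Gg _] /twfamP[Gh _] e; rewrite -(twcoefsK Gg) e twcoefsK.
transitivity #|family (fun i : 'I_N => S i.+1)|.
  apply: eq_card => y; apply/imsetP/familyP => [[g /twfamP[_ Sg] -> i] | Sy].
    by rewrite -tcoef_ord; apply: Sg; rewrite /= ltn_ord.
  exists (twelt y); last by rewrite tweltK.
  apply/twfamP; split=> [|[|k] // kN]; first exact: mem_twelt.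
  by rewrite /twcoef tweltK (tcoef_ord _ (Ordinal kN)); apply: Sy.
by rewrite card_family foldrE big_map -big_enum.
Qed.

Lemma card_tw_group : #|G| = (#|K| ^ N)%N.
Proof.
transitivity #|twfam (fun=> setT)|.
  apply: eq_card => g; apply/idP/twfamP => [Gg | []//].
  by split=> // k _; rewrite inE.
by rewrite card_twfam cardsT prod_nat_const card_ord.
Qed.


Lemma twcoefM_mid g h k : g \in G -> h \in G -> (0 < k <= N)%N ->
  twcoef (g * h)%g k = twcoef g k + twcoef h k
    + \sum_(1 <= i < k) twcoef g i * twcoef h (k - i) ^+ (q ^ i).
Proof.
move=> Gg Gh /andP[k0 kN]; rewrite twcoefM // -(big_mkord xpredT
  (fun i => twcoef g i * twcoef h (k - i) ^+ (q ^ i))).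
rewrite big_ltn // big_nat_recr //= subn0 subnn twcoef0 mul1r expr1 expr1n mulr1.
by rewrite addrCA addrC [twcoef h k + _]addrC.
Qed.

(** * Multiplication by 1 + b t^j *)

Section Monomial.

Variables (g a : GL) (b : K) (j : nat).
Hypotheses (Gg : g \in G) (Ga : a \in G) (j_gt0 : (0 < j)%N).
Hypothesis gE : forall k, (0 < k <= N)%N -> twcoef g k = if k == j then b else 0.

Lemma monomial_mull k : (0 < k <= N)%N ->
  twcoef (g * a)%g k = twcoef g k + twcoef a k
    + (if (j < k)%N then b * twcoef a (k - j) ^+ (q ^ j) else 0).
Proof.
move=> /andP[k0 kN]; rewrite twcoefM_mid ?k0 //; congr (_ + _).
rewrite big_nat (eq_bigr (fun i => if i == j then
  b * twcoef a (k - j) ^+ (q ^ j) else 0)) => [|i /andP[i0 ik]]; last first.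
  rewrite gE ?i0 ?(leq_trans (ltnW ik)) //.
  by case: eqP => [->|_] //; rewrite mul0r.
rewrite -big_nat -big_mkcond /=; case: ltnP => [jk | kj].
  by rewrite -big_filter filter_pred1_uniq ?iota_uniq ?mem_index_iota ?j_gt0 ?big_seq1.
rewrite big_nat_cond big_pred0 // => i.
by case: eqP => [->|_]; rewrite ?andbF // [(j < k)%N]ltnNge kj andbF.
Qed.

Lemma monomial_mulr k : (0 < k <= N)%N ->
  twcoef (a * g)%g k = twcoef a k + twcoef g k
    + (if (j < k)%N then twcoef a (k - j) * b ^+ (q ^ (k - j)) else 0).
Proof.
move=> /andP[k0 kN]; rewrite twcoefM_mid ?k0 //; congr (_ + _).
(* After reversal the index is the exponent taken from [g], and only the term [i = j] survives. *)
rewrite big_nat_rev big_nat (eq_bigr (fun i => if i == j then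
  twcoef a (k - j) * b ^+ (q ^ (k - j)) else 0)) => [|i /andP[i0 ik]]; last first.
  rewrite add1n subSS subKn ?(ltnW ik) // gE ?i0 ?(leq_trans (ltnW ik)) //.
  by case: eqP => [->|_] //; rewrite exprq0 mulr0.
rewrite -big_nat -big_mkcond /=; case: ltnP => [jk | kj].
  by rewrite -big_filter filter_pred1_uniq ?iota_uniq ?mem_index_iota ?j_gt0 ?big_seq1.
rewrite big_nat_cond big_pred0 // => i.
by case: eqP => [->|_]; rewrite ?andbF // [(j < k)%N]ltnNge kj andbF.
Qed.

End Monomial.

(** * The central subgroup of the elements 1 + a t^N *)

Definition topS (i : nat) : {set K} := if i == N then setT else [set 0].

Lemma top_coef z k : z \in twfam topS -> (0 < k < N)%N -> twcoef z k = 0.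
Proof.
case/twfamP=> _ Sz /andP[k0 kN]; have := Sz k.
by rewrite k0 ltnW // /topS ltn_eqF // inE => /(_ isT)/eqP.
Qed.

Lemma topP z : reflect (z \in G /\ forall k, (0 < k < N)%N -> twcoef z k = 0)
                       (z \in twfam topS).
Proof.
apply: (iffP idP) => [Zz | [Gz z0]].
  by split=> [|k]; [case/twfamP: Zz | exact: top_coef].
apply/twfamP; split=> // k /andP[k0 kN]; rewrite /topS.
by case: eqP => [|/eqP nk]; rewrite inE ?z0 // k0 ltn_neqAle nk.
Qed.

Lemma top_mull z g k : z \in twfam topS -> g \in G -> (0 < k <= N)%N ->
  twcoef (z * g)%g k = twcoef z k + twcoef g k.
Proof.
move=> Zz Gg kN; have [Gz _] := twfamP _ _ Zz.
rewrite twcoefM_mid // [X in _ + X]big_nat big1 ?addr0 // => i /andP[i0 ik].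
by rewrite (top_coef Zz) ?mul0r // i0 (leq_trans ik) //; case/andP: kN.
Qed.

Lemma top_mulr z g k : z \in twfam topS -> g \in G -> (0 < k <= N)%N ->
  twcoef (g * z)%g k = twcoef g k + twcoef z k.
Proof.
move=> Zz Gg kN; have [Gz _] := twfamP _ _ Zz.
rewrite twcoefM_mid // [X in _ + X]big_nat big1 ?addr0 // => i /andP[i0 ik].
rewrite (top_coef Zz) ?exprq0 ?mulr0 //; lia.
Qed.

Lemma top_group_set : group_set (twfam topS).
Proof.
apply/group_setP; split=> [|g h Zg Zh].
  by apply/topP; split=> // k /andP[k0 _]; apply: twcoef1.
have [[Gg _] [Gh _]] := (twfamP _ _ Zg, twfamP _ _ Zh).
apply/topP; split=> [|k /andP[k0 kN]]; first exact: groupM.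
have kN' := ltnW kN; rewrite top_mull ?k0 //.
by rewrite (top_coef Zg) ?(top_coef Zh) ?addr0 // k0.
Qed.

Definition top_group : {group GL} := Group top_group_set.

Lemma top_central : top_group \subset 'Z(G).
Proof.
apply/subsetP => z Zz; have [Gz _] := twfamP _ _ Zz.
apply/centerP; split=> // g Gg; apply: twcoef_inj; rewrite ?groupM // => k kN.
by rewrite top_mull // top_mulr // addrC.
Qed.

Lemma card_top_group : (0 < N)%N -> #|top_group| = #|K|.
Proof.
move=> N0; rewrite card_twfam.
have lt : (N.-1 < N)%N by rewrite prednK.
rewrite (bigD1 (Ordinal lt)) //= prednK // /topS eqxx cardsT.
rewrite big1 => [|i ni]; first exact: muln1.
rewrite ifN ?cards1 //; apply: contraNneq ni => iN; rewrite -val_eqE /=; lia.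
Qed.

Lemma twelt_top_coef a k : (0 < k <= N)%N ->
  twcoef (twelt (top_elt N a)) k = if k == N then a else 0.
Proof.
case: k => // k kN; rewrite /twcoef tweltK (tcoef_ord _ (Ordinal kN)).
by rewrite ffunE.
Qed.

Lemma twelt_top a : twelt (top_elt N a) \in top_group.
Proof.
apply/topP; split=> [|k /andP[k0 kN]]; first exact: mem_twelt.
by rewrite twelt_top_coef ?k0 ?(ltnW kN) // ltn_eqF.
Qed.

Lemma top_twelt z : z \in top_group -> z = twelt (top_elt N (twcoef z N)).
Proof.
move=> Zz; have [Gz z0] := topP _ Zz.
apply: twcoef_inj; rewrite ?mem_twelt // => k kN.
rewrite twelt_top_coef //; case: eqP => [-> // | /eqP nk].
by apply: z0; lia.
Qed.

Lemma twelt_eq g y : GLval g = tw_mx q y -> g = twelt y.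
Proof. by move=> e; apply: val_inj; rewrite /= -/(GLval _) tweltE. Qed.

Section TopCharacter.

Variables (F : fieldType) (psi : K -> F).
Hypotheses (N_gt0 : (0 < N)%N) (psi_char : additive_character psi).

Definition top_char g : F := psi (twcoef g N).

Lemma top_charM :
  {in top_group &, forall g h, top_char (g * h)%g = top_char g * top_char h}.
Proof.
move=> x y Zx Zy; have [Gy _] := twfamP _ _ Zy; case: psi_char => psiD _.
by rewrite /top_char top_mull ?N_gt0 ?leqnn.
Qed.

Lemma top_char_neq0 : {in top_group, forall z, top_char z != 0}.
Proof. by move=> z _; case: psi_char => _ ->. Qed.

(** This turns the last clauses of [A_psi] (with [s] the identity) and of [G_psi] (with [s] the
    scalar matrices) into one condition on [top_group]. *)
Lemma top_scalarP (T : Type) (f : GL -> T) (s : F -> T) :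
  (forall a g, g \in G -> GLval g = tw_mx q (top_elt N a) -> f g = s (psi a))
  <-> {in top_group, forall z, f z = s (top_char z)}.
Proof.
split=> [fE z Zz | fE a g Gg e].
  by rewrite {1}(top_twelt Zz); apply: fE; rewrite ?mem_twelt ?tweltE.
rewrite (twelt_eq e) fE ?twelt_top // /top_char twelt_top_coef ?eqxx //.
by rewrite N_gt0 leqnn.
Qed.

End TopCharacter.

End TwistedGroup.

Lemma tw_group1_abelian (K : finFieldType) (N : nat) : abelian (tw_group K 1 N).
Proof.
have D (x y : K) : (x + y) ^+ 1 = x ^+ 1 + y ^+ 1 by rewrite !expr1.
apply/centsP => g Gg h Gh; apply: (twcoef_inj D); rewrite ?groupM // => k kN.
rewrite !(twcoefM_mid D) // [_ + twcoef h k]addrC; congr (_ + _).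
rewrite big_nat_rev; apply: eq_big_nat => i /andP[i0 ik].
have -> : (1 + k - i.+1 = k - i)%N by lia.
by rewrite !exp1n !expr1 subKn ?(ltnW ik) // mulrC.
Qed.

(** * Degrees *)

Section Polarization.

Variables (K : finFieldType) (q m : nat).
Hypothesis qD : forall x y : K, (x + y) ^+ q = x ^+ q + y ^+ q.
Hypothesis q_gt1 : (1 < q)%N.
Hypothesis cardK : #|K| = (q ^ 2)%N.
Hypothesis m_gt0 : (0 < m)%N.

Local Notation GL := {'GL_(2 * m).+1[K]}.
Local Notation G := (tw_group K q (2 * m)).
Local Notation fam := (@twfam K q (2 * m)).
Implicit Types (g h x y : GL).

Let q_gt0 : (0 < q)%N := ltnW q_gt1.

(** * The q-th power map of K *)

Lemma exprqq (a : K) : (a ^+ q) ^+ q = a.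
Proof. by rewrite -exprM mulnn -cardK expf_card. Qed.

Lemma exprqX (a : K) i : a ^+ (q ^ i) = if odd i then a ^+ q else a.
Proof.
elim: i => [|i IHi]; first by rewrite expr1.
by rewrite expnSr exprM IHi /=; case: (odd i); rewrite ?exprqq.
Qed.

Lemma expr0q : 0 ^+ q = 0 :> K.
Proof. by rewrite expr0n -leqn0 leqNgt q_gt0. Qed.

Lemma exprqN (a : K) : (- a) ^+ q = - a ^+ q.
Proof. by apply/eqP; rewrite -addr_eq0 -qD addNr expr0q. Qed.

Definition qfix : {set K} := [set a | a ^+ q == a].

(* [a |-> a^q - a] is additive, its fibres are translates of [qfix] and its values are roots
   of [X^q + X], whence [q^2 <= q * #|qfix|]. *)
Lemma card_qfix : (q <= #|qfix|)%N.
Proof.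
pose f (a : K) := a ^+ q - a.
have le_im : (#|f @: K| <= q)%N.
  pose P : {poly K} := 'X^q + 'X.
  have sP : size P = q.+1.
    by rewrite /P size_polyDl size_polyXn // size_polyX ltnS.
  have nzP : P != 0 by rewrite -size_poly_eq0 sP.
  rewrite cardE -ltnS -sP max_poly_roots ?enum_uniq //.
  apply/allP => b; rewrite mem_enum => /imsetP[a _ ->].
  rewrite rootE /P hornerD hornerXn hornerX /f qD exprqN exprqq.
  by rewrite addrA subrK subrr.
have fib b : (#|[set a | f a == b]| <= #|qfix|)%N.
  have [a /= /eqP fa | e] := pickP [pred a | f a == b]; last first.
    by rewrite eq_card0 // => a; rewrite inE; apply: e.
  rewrite -(card_imset _ (addIr (- a))).
  apply: subset_leq_card; apply/subsetP => _ /imsetP[c + ->].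
  rewrite !inE qD exprqN => /eqP fc.
  have -> : c ^+ q = a ^+ q - a + c by rewrite -/(f a) fa -fc subrK.
  by rewrite addrAC [a ^+ q - a]addrC addrK addrC.
have : (#|K| <= #|f @: K| * #|qfix|)%N.
  rewrite -[#|K|]sum1_card (partition_big f [in f @: K]) /= => [|a _]; last exact: imset_f.
  apply: (@leq_trans (\sum_(b in f @: K) #|qfix|)); last by rewrite sum_nat_const.
  apply: leq_sum => b _; apply: leq_trans (fib b); rewrite -sum1_card.
  by apply/eq_leq/eq_bigl => a; rewrite inE.
rewrite cardK -mulnn => h; rewrite -(leq_pmul2l q_gt0).
by apply: leq_trans h _; rewrite leq_mul2r le_im orbT.
Qed.

(* Allowed values of the i-th coefficient in [pol], in [iso], and in a subgroup of [iso]
   that contains the commutators of [pol]. *)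
Definition oddS i : {set K} :=
  if (i < m)%N then [set 0] else if i == m then qfix else setT.
Definition polS i := if odd i then oddS i else setT.
Definition isoS i :=
  if odd i then oddS i else if i == (2 * m)%N then setT else [set 0].
Definition derS i : {set K} := if odd i && (m < i)%N then setT else [set 0].

(** * The subgroup [pol] *)

Lemma pol_lt h k : h \in fam polS -> odd k -> (k < m)%N -> twcoef h k = 0.
Proof.
case/twfamP=> _ Sh ok km; have := Sh k; rewrite /polS ok /oddS km inE.
by move=> /(_ _)/eqP-> //; case: k ok km {Sh} => // k _ km; lia.
Qed.

Lemma pol_fix h : h \in fam polS -> odd m -> twcoef h m ^+ q = twcoef h m.
Proof.
case/twfamP=> _ Sh om; have := Sh m; rewrite /polS om /oddS ltnn eqxx inE.
by move=> /(_ _)/eqP-> //; lia.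
Qed.

Lemma polP h : h \in G ->
    (forall k, odd k -> (k < m)%N -> twcoef h k = 0) ->
    (odd m -> twcoef h m ^+ q = twcoef h m) -> h \in fam polS.
Proof.
move=> Gh h0 hm; apply/twfamP; split=> // k _; rewrite /polS /oddS.
case: ifP => ok; last by rewrite inE.
case: ltnP => km; first by rewrite inE h0.
by case: eqP => [ek|_]; rewrite inE // ek hm // -ek.
Qed.

(** In each cross term one of the exponents i, k - i is odd and below m, so the term vanishes. *)
Lemma pol_mul_odd g h k : g \in fam polS -> h \in fam polS -> odd k ->
  (k <= m)%N -> twcoef (g * h)%g k = twcoef g k + twcoef h k.
Proof.
move=> Hg Hh ok km; have [[Gg _] [Gh _]] := (twfamP _ _ _ Hg, twfamP _ _ _ Hh).
rewrite (twcoefM_mid qD) //; last by case: (k) ok km => //; lia.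
rewrite [X in _ + X]big_nat big1 ?addr0 // => i /andP[i0 ik].
have [oi | ei] := boolP (odd i).
  by rewrite (pol_lt Hg) ?mul0r //; lia.
rewrite (pol_lt Hh) ?exprq0 ?mulr0 //; last lia.
by rewrite oddB ?ok ?(negPf ei) // ltnW.
Qed.

Lemma pol_group_set : group_set (fam polS).
Proof.
apply/group_setP; split=> [|g h Hg Hh].
  apply: polP => [|[|k] //|]; first exact: group1.
    by rewrite twcoef1.
  by rewrite twcoef1 ?expr0q.
have [[Gg _] [Gh _]] := (twfamP _ _ _ Hg, twfamP _ _ _ Hh).
apply: polP => [|k ok km|om]; first exact: groupM.
  by rewrite pol_mul_odd // ?(pol_lt Hg) ?(pol_lt Hh) ?addr0 // ltnW.
by rewrite pol_mul_odd // qD !pol_fix.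
Qed.

Definition pol_group : {group GL} := Group pol_group_set.

(** Elements of [pol] commute up to odd coefficients above m. For even k, terms with two even
    exponents are untwisted and hence symmetric. Of two odd exponents with sum at most 2m one is
    below m and kills the term, unless both equal m; then the coefficients are fixed by the q-th
    power. *)
Lemma pol_comm g h k : g \in pol_group -> h \in pol_group ->
    (0 < k <= 2 * m)%N -> (odd k -> k <= m)%N ->
  twcoef (g * h)%g k = twcoef (h * g)%g k.
Proof.
move=> Hg Hh kN okm; have [[Gg _] [Gh _]] := (twfamP _ _ _ Hg, twfamP _ _ _ Hh).
have [ok | ek] := boolP (odd k); first by rewrite !pol_mul_odd ?okm // addrC.
rewrite !(twcoefM_mid qD) // [_ + twcoef h k]addrC; congr (_ + _).
rewrite big_nat_rev; apply: eq_big_nat => i /andP[i0 ik].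
have -> : (1 + k - i.+1 = k - i)%N by lia.
rewrite subKn ?(ltnW ik) // !exprqX oddB ?(ltnW ik) // (negPf ek) /=.
have [oi | _] := boolP (odd i); last by rewrite mulrC.
have oki : odd (k - i) by rewrite oddB ?(ltnW ik) // (negPf ek) oi.
have [im | mi | im] := ltngtP i m.
- by rewrite (pol_lt Hh) // expr0q mulr0 mul0r.
- by rewrite (pol_lt Hg oki) ?expr0q ?mulr0 ?mul0r //; lia.
subst i; have [km | km] := ltnP (k - m) m.
  by rewrite (pol_lt Hg oki) // expr0q mulr0 mul0r.
have -> : (k - m = m)%N by lia.
by rewrite !pol_fix // mulrC.
Qed.

(** * The subgroup [der] and the commutators of [pol] *)

Lemma der_coef u k : u \in fam derS -> (0 < k <= 2 * m)%N -> (odd k -> k <= m)%N ->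
  twcoef u k = 0.
Proof.
case/twfamP=> _ Su kN okm; have := Su k kN; rewrite /derS.
case: ifP => [/andP[ok mk] | _]; last by rewrite inE => /eqP.
by have := okm ok; lia.
Qed.

Lemma derP u : u \in G ->
  (forall k, (0 < k <= 2 * m)%N -> (odd k -> k <= m)%N -> twcoef u k = 0) ->
  u \in fam derS.
Proof.
move=> Gu u0; apply/twfamP; split=> // k kN; rewrite /derS.
case: ifP => [_ | /negbT nk]; first by rewrite inE.
rewrite inE u0 // => ok; rewrite leqNgt; apply: contra nk => mk.
by rewrite ok.
Qed.

Lemma der_group_set : group_set (fam derS).
Proof.
apply/group_setP; split=> [|g h Og Oh].
  by apply: derP => [|k /andP[k0 _] _]; [exact: group1 | rewrite twcoef1].
have [[Gg _] [Gh _]] := (twfamP _ _ _ Og, twfamP _ _ _ Oh).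
apply: derP => [|k kN okm]; first exact: groupM.
rewrite (twcoefM_mid qD) // (der_coef Og) // (der_coef Oh) // add0r add0r.
rewrite big_nat big1 // => i /andP[i0 ik].
have [iodd | ieven] := boolP (odd i && (m < i)%N).
  by rewrite (der_coef Oh) ?exprq0 ?mulr0 //; lia.
rewrite (der_coef Og) ?mul0r //; first lia.
by move=> oi; rewrite leqNgt; apply: contra ieven => ->; rewrite oi.
Qed.

Definition der_group : {group GL} := Group der_group_set.

Lemma der_sub_pol : der_group \subset pol_group.
Proof.
apply/subsetP => u Ou; have [Gu _] := twfamP _ _ _ Ou.
apply: polP => // [k ok km | om].
  by apply: der_coef => //; first (by case: (k) ok km => //; lia); rewrite ltnW.
by rewrite (der_coef Ou) ?expr0q //; lia.
Qed.

(** By induction on k, the coefficient of [u] is isolated once the cross terms vanish. If i is odd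
    and above m, then k is even and k - i is odd and below m, where [y] has no coefficient; for the
    other i the induction hypothesis applies to [u]. *)
Lemma der_group_agree u y : u \in pol_group -> y \in pol_group ->
    (forall k, (0 < k <= 2 * m)%N -> (odd k -> k <= m)%N ->
       twcoef (u * y)%g k = twcoef y k) ->
  u \in der_group.
Proof.
move=> Hu Hy uy; have [[Gu _] [Gy _]] := (twfamP _ _ _ Hu, twfamP _ _ _ Hy).
apply: derP => // k; elim/ltn_ind: k => k IH kN okm.
have := uy k kN okm; rewrite (twcoefM_mid qD) // -[RHS]add0r [_ u k + _]addrC.
rewrite -addrA addrC => /addIr; rewrite [X in _ + X]big_nat big1 ?addr0 //.
move=> i /andP[i0 ik]; have [iodd | ieven] := boolP (odd i && (m < i)%N).
  have [oi mi] := andP iodd; rewrite (pol_lt Hy) ?exprq0 ?mulr0 //; last lia.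
  rewrite oddB ?(ltnW ik) // oi; case ok: (odd k) => //.
  by have := okm ok; lia.
rewrite IH ?mul0r //; first lia.
by move=> oi; rewrite leqNgt; apply: contra ieven => ->; rewrite oi.
Qed.

Lemma der1_pol_sub : pol_group^`(1)%g \subset der_group.
Proof.
rewrite gen_subG; apply/subsetP => _ /imset2P[x y Hx Hy ->].
(* Multiplying [[~ x, y]] by [y^-1 * x^-1] gives [x^-1 * y^-1], and [pol_comm] compares the two
   products. *)
apply: (@der_group_agree _ (y^-1 * x^-1)%g);
  rewrite ?groupR ?groupM ?groupV // => k kN okm.
have -> : ([~ x, y] * (y^-1 * x^-1) = x^-1 * y^-1)%g.
  by rewrite commgEl conjgE !mulgA mulgK mulgK.
by rewrite pol_comm ?groupV.
Qed.

(** * The subgroup [iso], and the orders of [iso] and [pol] *)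

Lemma iso_lt a k : a \in fam isoS -> (0 < k < m)%N -> twcoef a k = 0.
Proof.
case/twfamP=> _ Sa km; have := Sa k; rewrite /isoS /oddS.
have -> : (k < m)%N by lia.
have -> : (k == (2 * m)%N) = false by lia.
by rewrite if_same inE => /(_ _)/eqP-> //; lia.
Qed.

Lemma iso_even a k : a \in fam isoS -> (0 < k < 2 * m)%N -> ~~ odd k ->
  twcoef a k = 0.
Proof.
case/twfamP=> _ Sa km ek; have := Sa k; rewrite /isoS (negPf ek).
have -> : (k == (2 * m)%N) = false by lia.
by rewrite inE => /(_ _)/eqP-> //; lia.
Qed.

Lemma iso_sub_pol : fam isoS \subset fam polS.
Proof.
apply/subsetP => a /twfamP[Ga Sa]; apply/twfamP; split=> // k kN.
by have := Sa k kN; rewrite /polS /isoS; case: (odd k); rewrite ?inE.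
Qed.

Lemma isoP a : a \in fam polS ->
    (forall k, (0 < k < 2 * m)%N -> ~~ odd k -> twcoef a k = 0) ->
  a \in fam isoS.
Proof.
case/twfamP=> Ga Sa ae; apply/twfamP; split=> // k kN; have := Sa k kN.
rewrite /polS /isoS; have [ok // | ek _] := boolP (odd k).
by case: eqP => [|/eqP nk]; rewrite inE // ae //; lia.
Qed.

(** A cross term in an even coefficient k below 2m needs i and k - i odd and both at least m, which
    is impossible. *)
Lemma iso_group_set : group_set (fam isoS).
Proof.
apply/group_setP; split=> [|g h Ag Ah].
  by apply: isoP => [|k /andP[k0 _] _]; [exact: (group1 pol_group) | rewrite twcoef1].
have [Hg Hh] := (subsetP iso_sub_pol g Ag, subsetP iso_sub_pol h Ah).
have [[Gg _] [Gh _]] := (twfamP _ _ _ Ag, twfamP _ _ _ Ah).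
apply: isoP => [|k kN ek]; first exact: (groupM (G := pol_group)).
rewrite (twcoefM_mid qD) //; last lia.
rewrite (iso_even Ag) // (iso_even Ah) // !add0r big_nat big1 // => i /andP[i0 ik].
have [oi | ei] := boolP (odd i); last by rewrite (iso_even Ag) ?mul0r //; lia.
have [im | mi] := ltnP i m; first by rewrite (iso_lt Ag) ?mul0r //; lia.
by rewrite (iso_lt Ah) ?exprq0 ?mulr0 //; lia.
Qed.

Definition iso_group : {group GL} := Group iso_group_set.

Lemma top_sub_iso : top_group (2 * m) qD q_gt0 \subset iso_group.
Proof.
apply/subsetP => z /topP[Gz z0].
have z0' k : (0 < k < 2 * m)%N -> twcoef z k = 0 by apply: z0.
apply: isoP => [|k kN _]; last exact: z0'.
apply: polP => // [k ok km|om]; last by rewrite z0' ?expr0q //; lia.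
by rewrite z0' //; case: (k) ok km => //; lia.
Qed.

(** The square of the product is paired along i and 2m - i. Each pair contributes at least q^2:
    either one index is above m and ranges over all of K, or both equal m and [card_qfix] applies
    twice. *)
Lemma prod_oddS : (q ^ m <= \prod_(j < m) #|oddS (2 * j).+1|)%N.
Proof.
have card_oddS j : #|oddS j| =
    if (j < m)%N then 1%N else if j == m then #|qfix| else (q ^ 2)%N.
  by rewrite /oddS; case: ifP => _; [rewrite cards1 | case: ifP; rewrite ?cardsT].
rewrite -(@leq_exp2r _ _ 2) // -!mulnn -expnMn mulnn.
rewrite {1}(reindex_inj rev_ord_inj) -big_split /=.
rewrite -[m in leqLHS]card_ord -prod_nat_const; apply: leq_prod => j _.
have jm := ltn_ord j; rewrite !card_oddS.
have := card_qfix.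
have -> : (2 * (m - j.+1)).+1 = (2 * m - (2 * j).+1)%N by lia.
case: (ltngtP (2 * j).+1 m) => jm'.
- have -> : (2 * m - (2 * j).+1 < m)%N = false by lia.
  have -> : (2 * m - (2 * j).+1 == m)%N = false by lia.
  by rewrite muln1.
- have -> : (2 * m - (2 * j).+1 < m)%N by lia.
  by rewrite mul1n.
have -> : (2 * m - (2 * j).+1 < m)%N = false by lia.
have -> : (2 * m - (2 * j).+1 == m)%N by lia.
by move=> qf; rewrite -mulnn leq_mul.
Qed.

Lemma prod_double (f : nat -> nat) n :
  (\prod_(i < 2 * n) f i = \prod_(j < n) (f (2 * j)%N * f (2 * j).+1))%N.
Proof.
elim: n => [|n IHn]; first by rewrite !big_ord0.
have -> : (2 * n.+1 = (2 * n).+2)%N by lia.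
by rewrite !big_ord_recr /= IHn mulnA.
Qed.

Lemma card_iso_group : (q ^ m * #|K| <= #|iso_group|)%N.
Proof.
(* Index 2j stands for exponent 2j + 1, so the first factor collects the odd exponents. *)
rewrite (card_twfam _ qD q_gt0) (prod_double (fun i => #|isoS i.+1|)) big_split /=.
apply: leq_mul.
  apply: leq_trans prod_oddS _; apply: leq_prod => j _.
  by rewrite /isoS mul2n /= odd_double.
(* The index [m.-1] stands for exponent 2m, the only even one whose coefficient is free. *)
have lt : (m.-1 < m)%N by rewrite prednK.
rewrite (bigD1 (Ordinal lt)) //= -[leqLHS]muln1; apply: leq_mul.
  have -> : (2 * m.-1).+2 = (2 * m)%N by lia.
  by rewrite /isoS eqxx mul2n odd_double cardsT.
by apply: prodn_gt0 => j; rewrite /isoS mul2n /= odd_double; case: eqP;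
   rewrite ?cardsT ?cards1 // cardK expn_gt0 q_gt0.
Qed.

Lemma card_pol_group : (q ^ m * #|K| ^ m <= #|pol_group|)%N.
Proof.
rewrite (card_twfam _ qD q_gt0) (prod_double (fun i => #|polS i.+1|)) big_split /=.
apply: leq_mul.
  apply: leq_trans prod_oddS _; apply: leq_prod => j _.
  by rewrite /polS mul2n /= odd_double.
rewrite -[m in leqLHS]card_ord -prod_nat_const; apply: leq_prod => j _.
by rewrite /polS mul2n /= odd_double cardsT.
Qed.

(** * The degree of an irreducible representation over psi *)

Section Representation.

Variables (F : closedFieldType) (psi : K -> F).
Hypotheses (charF0 : [pchar F] =i pred0) (psiA : additive_character psi).
Hypothesis psi_cond : conductor_q2 q psi.
Variables (n : nat) (rG : mx_representation F G n).
Hypothesis irrG : mx_irreducible rG.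
Hypothesis topG :
  {in top_group (2 * m) qD q_gt0, forall z, rG z = (top_char psi z)%:M}.

(* Conjugation by [1 + b t^(2m - i)] multiplies [a] by the central element with
   coefficient [b a_i^q - a_i b^q], on which [psi] is nontrivial for some [b]. *)
Lemma mxtrace_odd_lead a i : a \in G -> odd i -> (i < 2 * m)%N ->
    twcoef a i != 0 -> (forall k, (0 < k < i)%N -> twcoef a k = 0) ->
  \tr (rG a) = 0.
Proof.
move=> Ga oi iN nz_ai a0; have [x psix] := psi_cond.
have i0 : (0 < i)%N by case: (i) oi.
(* With b a_i^q = x one gets a_i b^q = x^q, as a_i^(q^2) = a_i. The discrepancy is then w = x - x^q,
   and psi(w) is not 1 by the choice of x. *)
pose b := x / twcoef a i ^+ q; pose w := x - x ^+ q.
have nz_aiq : twcoef a i ^+ q != 0 by rewrite expf_neq0.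
have bE : b * twcoef a i ^+ q = x by rewrite /b divfK.
clearbody b.
have wE : x = twcoef a i * b ^+ q + w.
  have -> : twcoef a i * b ^+ q = x ^+ q by rewrite -bE exprMn exprqq mulrC.
  by rewrite addrC subrK.
pose j := (2 * m - i)%N.
have jN : (j < 2 * m)%N by rewrite ltn_subrL i0 (leq_trans i0 (ltnW iN)).
have j0 : (0 < j)%N by rewrite subn_gt0.
have kj : (2 * m - j = i)%N by rewrite subKn // ltnW.
have [g Gg gE] := twcoef_exists (2 * m) qD q_gt0 (fun k => if k == j then b else 0).
pose z := twelt q (top_elt (2 * m) w).
have Zz : z \in top_group (2 * m) qD q_gt0 by apply: twelt_top.
have [Gz _] := twfamP _ _ _ Zz.
have oj : odd j by rewrite oddB ?(ltnW iN) // mul2n odd_double oi.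
have swap : (g * a = a * g * z)%g.
  apply: (twcoef_inj qD q_gt0); rewrite ?groupM // => k kN.
  rewrite (top_mulr qD q_gt0 Zz) ?groupM // twelt_top_coef //.
  rewrite (monomial_mull qD q_gt0 Gg Ga j0 gE) //.
  rewrite (monomial_mulr qD q_gt0 Gg Ga j0 gE) //.
  rewrite [twcoef a k + twcoef g k]addrC -[RHS]addrA; congr (_ + _).
  (* Below the top degree the cross terms involve a coefficient of [a] of exponent k - j < i, which
     is zero. At the top both twists are q-th powers, since i and j are odd. *)
  have [-> | nk] := eqVneq k (2 * m)%N.
    by rewrite jN kj (exprqX _ j) (exprqX _ i) oj oi bE.
  rewrite addr0; case: ifP => // jk.
  have kji : (0 < k - j < i)%N.
    rewrite subn_gt0 jk ltn_subLR ?(ltnW jk) // addnC subnKC ?(ltnW iN) //.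
    by rewrite ltn_neqAle nk; case/andP: kN.
  by rewrite a0 // exprq0 // mul0r mulr0.
have psiw : top_char psi z != 1.
  case: psiA => psiD psi0; rewrite /top_char twelt_top_coef ?eqxx; last lia.
  apply: contraNneq psix => psiw1; apply/eqP.
  by rewrite -[RHS](congr1 psi (subrK (x ^+ q) x)) psiD psiw1 mul1r.
(* Taking traces in a = g^-1 a g z gives tr a = psi(w) tr a. *)
have := congr1 (fun g' => \tr (rG (g^-1 * g')%g)) swap.
rewrite mulKg -!mulgA !repr_mxM ?groupM ?groupV // (topG Zz).
rewrite !mulmxA mul_mx_scalar mxtraceZ -mulmxA mxtrace_mulC -mulmxA.
rewrite -repr_mxM ?groupV // mulgV repr_mx1 mulmx1 => /eqP.
rewrite -subr_eq0 -{1}[\tr _]mul1r -mulrBl mulf_eq0 subr_eq0 eq_sym.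
by rewrite (negPf psiw) => /eqP.
Qed.

Lemma mxtrace_iso_group : {in iso_group :\: top_group (2 * m) qD q_gt0,
  forall a, \tr (rG a) = 0}.
Proof.
move=> a /setDP[Aa Za]; have [Ga _] := twfamP _ _ _ Aa.
have ex : exists i, (0 < i < 2 * m)%N && (twcoef a i != 0).
  have [i /andP[iN nz]|a0] := pickP (fun i : 'I_(2 * m) => (0 < i)%N && (twcoef a i != 0)).
    by exists i; rewrite iN nz ltn_ord.
  case/topP: Za; split=> // k /andP[k0 kN]; apply/eqP.
  by have := a0 (Ordinal kN); rewrite /= k0 => /negbFE.
case: (ex_minnP ex) => i /andP[iN nz] imin.
have oi : odd i by apply: contraR nz => ei; rewrite (iso_even Aa).
apply: (mxtrace_odd_lead (i := i)) => //; first by case/andP: iN.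
move=> k /andP[k0 ki]; have [//|nzk] := eqVneq (twcoef a k) 0.
have [_ i2m] := andP iN; have := imin k; rewrite k0 nzk (ltn_trans ki i2m).
by move=> /(_ isT); rewrite leqNgt ki.
Qed.

Lemma der_sub_iso : der_group \subset iso_group.
Proof.
apply/subsetP => u Ou; apply: isoP => [|k kN ek].
  exact: (subsetP der_sub_pol).
by rewrite (der_coef Ou) ?(negPf ek) //; lia.
Qed.

Lemma G_psi_dim : n = (q ^ m)%N.
Proof.
have n_gt0 : (0 < n)%N by case/mx_irrP: irrG.
have sHG : pol_group \subset G by apply/subsetP => h /twfamP[].
(* The coefficient 2m is even, hence zero on [der]. So [der] meets the centre part [top_group] only
   in 1, and the sum reduces to the term n. *)
have sum_der : \sum_(u in der_group) \tr (rG u) != 0.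
  rewrite (bigD1 1%g) ?group1 //= big1 ?addr0 => [|u /andP[Ou u1]].
    by rewrite repr_mx1 mxtrace1 -[0]/(0%:R) pchar0_eqr_nat // -lt0n.
  apply: mxtrace_iso_group; apply/setDP; split; first exact: (subsetP der_sub_iso).
  apply: contra u1 => Zu; have [Gu _] := twfamP _ _ _ Ou.
  apply/eqP/(twcoef_inj qD q_gt0); rewrite ?group1 // => k kN.
  rewrite twcoef1; last by case/andP: kN.
  have [k2 | nk] := eqVneq k (2 * m)%N.
    by apply: der_coef Ou kN _; rewrite k2 mul2n odd_double.
  by rewrite (top_coef Zu) //; lia.
have [v nzv vH] := der1_eigenvector sHG der_sub_pol der1_pol_sub sum_der.
have le_n := irr_eigenvector_dim irrG sHG nzv vH.
have sAH : iso_group \subset pol_group := iso_sub_pol.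
have ge_n : (#|iso_group| <= #|top_group (2 * m) qD q_gt0| * n)%N.
  apply: (eigenvector_dim_ge charF0 _ top_sub_iso nzv _ _ mxtrace_iso_group).
  - exact: subset_trans sAH sHG.
  - by move=> a /(subsetP sAH); apply: vH.
  - by move=> z Zz; rewrite topG // scalar_mx_is_scalar.
have K_gt0 : (0 < #|K|)%N by rewrite cardK expn_gt0 q_gt0.
apply/eqP; rewrite eqn_leq; apply/andP; split; last first.
  rewrite -(leq_pmul2l K_gt0) mulnC (leq_trans card_iso_group) //.
  by rewrite (leq_trans ge_n) // card_top_group //; lia.
(* As [pol] has order at least q^(3m) and the whole group has order q^(4m), the index bound gives n
   <= q^m. *)
have := leq_mul card_pol_group le_n.
rewrite (Lagrange sHG) (card_tw_group _ qD q_gt0) cardK -!expnM -expnD.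
have -> : (2 * (2 * m) = (m + 2 * m) + m)%N by lia.
by rewrite [X in (_ <= X)%N]expnD leq_pmul2l // expn_gt0 q_gt0.
Qed.

End Representation.

End Polarization.

(** * Counting *)

(** Elements with the same rank in the two enumerations are matched; [j0] is the value outside
    [A]. *)
Lemma bijection_of_card (I J : finType) (A : {set I}) (B : {set J}) (j0 : J) :
    #|A| = #|B| ->
  exists2 f : I -> J, {in A &, injective f} & f @: A = B.
Proof.
move=> eqAB; pose f i := nth j0 (enum B) (index i (enum A)).
have lt i : i \in A -> (index i (enum A) < size (enum B))%N.
  by move=> Ai; rewrite -cardE -eqAB cardE index_mem mem_enum.
have f_inj : {in A &, injective f}.
  move=> i j Ai Aj /eqP; rewrite nth_uniq ?lt ?enum_uniq // => /eqP e.
  have := congr1 (nth i (enum A)) e.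
  by rewrite !nth_index ?mem_enum.
exists f => //; apply/eqP; rewrite eqEcard card_in_imset // eqAB leqnn andbT.
by apply/subsetP => _ /imsetP[i Ai ->]; rewrite -mem_enum mem_nth ?lt.
Qed.

Section LinearRepresentations.

Variables (F : closedFieldType) (gT : finGroupType) (G : {group gT}).
Hypothesis charF0 : [pchar F] =i pred0.
Implicit Type chi : gT -> F.

(** The degrees enter through equations because [irr_degree i] equals 1 only provably. *)
Lemma mx_rsim_linear n1 n2 (r1 : mx_representation F G n1)
    (r2 : mx_representation F G n2) chi :
    n1 = 1%N -> n2 = 1%N -> {in G, forall x, r1 x = (chi x)%:M} ->
    {in G, forall x, r2 x = (chi x)%:M} ->
  mx_rsim r1 r2.
Proof.
move=> e1 e2; subst n1 n2 => E1 E2; exists 1%:M => // [|x Gx].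
  by rewrite row_free_unit unitmx1.
by rewrite mul1mx mulmx1 E1 ?E2.
Qed.

Lemma linear_irr_exists (sG : irrType F G) chi :
    {in G &, forall x y, chi (x * y)%g = chi x * chi y} ->
    {in G, forall x, chi x != 0} ->
  exists i : sG, {in G, forall x, irr_repr i x = (chi x)%:M}.
Proof.
move=> chiM chi0.
have chi1 : chi 1%g = 1.
  apply: (mulfI (chi0 _ (group1 G))); rewrite mulr1 -chiM ?group1 //.
  by rewrite mulg1.
have reprP : mx_repr G (fun x => (chi x)%:M : 'M[F]_1).
  by split=> [|x y Gx Gy]; rewrite ?chi1 // chiM // scalar_mxM.
pose r := MxRepresentation reprP.
have irr_r : mx_irreducible r by apply: mx_abs_irrW; apply: linear_mx_abs_irr.
exists (irr_comp sG r) => x Gx.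
apply: (mx_rsim_scalar Gx (rsim_irr_comp_pchar sG (pchar0_pgroup charF0 G) irr_r)).
by [].
Qed.

Lemma irr_rsim_inj (sG : irrType F G) (i j : sG) :
  mx_rsim (irr_repr i) (irr_repr j) -> i = j.
Proof.
move/(irr_comp_rsim_pchar sG (pchar0_pgroup charF0 G)).
by rewrite !irr_reprK_pchar ?pchar0_pgroup.
Qed.

Lemma card_irr_over (Z : {group gT}) (psi : gT -> F) (sG : irrType F G) d :
    Z \subset 'Z(G) -> {in Z &, forall x y, psi (x * y)%g = psi x * psi y} ->
    {in Z, forall z, psi z != 0} ->
    (forall i : sG, {in Z, forall z, irr_repr i z = (psi z)%:M} ->
       irr_degree i = d) ->
  (#|[set i : sG | [forall z in Z, irr_repr i z == (psi z)%:M]]| * (d ^ 2 * #|Z|)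
     = #|G|)%N.
Proof.
move=> sZ psiM psi0 dE; rewrite -(sum_irr_over charF0 sG sZ psiM psi0) -sum_nat_const.
apply: eq_big => i; first by rewrite inE.
rewrite inE => /forall_inP over; rewrite dE // => z Zz.
exact/eqP/over.
Qed.

End LinearRepresentations.

Theorem theorem2p1
  (p q ell h : nat) (K : finFieldType) (F : closedFieldType) (psi : K -> F) :
  prime p -> (exists2 k, (0 < k)%N & q = (p ^ k)%N) ->
  prime ell -> ell != p -> (2 <= h)%N ->
  #|K| = (q ^ 2)%N -> p \in [pchar K] ->
  [pchar F] =i pred0 ->
  additive_character psi -> conductor_q2 q psi ->
  (exists Phi : ({'GL_(h - 1).+1[K]} -> F) ->
                {n : nat & mx_representation F (Ucal K q h) n},
     [/\ forall chi, A_psi h psi chi -> G_psi psi (projT2 (Phi chi)),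
         forall chi1 chi2, A_psi h psi chi1 -> A_psi h psi chi2 ->
           {in UL K h, chi1 =1 chi2} ->
           mx_rsim (projT2 (Phi chi1)) (projT2 (Phi chi2)),
         forall chi1 chi2, A_psi h psi chi1 -> A_psi h psi chi2 ->
           mx_rsim (projT2 (Phi chi1)) (projT2 (Phi chi2)) ->
           {in UL K h, chi1 =1 chi2} &
         forall n (rG : mx_representation F (Ucal K q h) n), G_psi psi rG ->
           exists2 chi, A_psi h psi chi & mx_rsim (projT2 (Phi chi)) rG])
  /\ (forall n (rG : mx_representation F (Ucal K q h) n), G_psi psi rG ->
        n = (q ^ (h - 1))%N).
Proof.
move=> p_pr [k k_gt0 qE] _ _ h_ge2 cardK charK charF0 psiA psi_cond.
have m_gt0 : (0 < h - 1)%N by rewrite subn_gt0.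
have N_gt0 : (0 < 2 * (h - 1))%N by rewrite muln_gt0.
have q_gt1 : (1 < q)%N by rewrite qE -(exp1n k) ltn_exp2r // prime_gt1.
pose q_gt0 : (0 < q)%N := ltnW q_gt1.
have K_gt0 : (0 < #|K|)%N by rewrite cardK expn_gt0 q_gt0.
have qD (x y : K) : (x + y) ^+ q = x ^+ q + y ^+ q.
  by apply: exprDn_pchar; rewrite (eq_pnat _ (pcharf_eq charK)) qE pnatX pnat_id.
have oneD (x y : K) : (x + y) ^+ 1 = x ^+ 1 + y ^+ 1 by rewrite !expr1.
pose ZU := top_group (2 * (h - 1)) qD q_gt0.
pose ZL := top_group (h - 1) oneD (ltn0Sn 0).
have topU n (rG : mx_representation F (Ucal K q h) n) :
    G_psi psi rG <->
    mx_irreducible rG /\ {in ZU, forall z, rG z = (top_char psi z)%:M}.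
  have E := top_scalarP qD q_gt0 psi N_gt0 rG (fun c => c%:M).
  by split=> -[irrG /E].
have dimG n (rG : mx_representation F (Ucal K q h) n) :
    G_psi psi rG -> n = (q ^ (h - 1))%N.
  case/topU=> irrG topG.
  exact: (G_psi_dim cardK m_gt0 charF0 psiA psi_cond irrG topG).
split=> //.
have topL (chi : {'GL_(h - 1).+1[K]} -> F) : A_psi h psi chi <->
    [/\ {in UL K h &, forall g1 g2, chi (g1 * g2)%g = chi g1 * chi g2},
        {in UL K h, forall g, chi g != 0} &
        {in ZL, forall z, chi z = top_char psi z}].
  have E := top_scalarP oneD (ltn0Sn 0) psi m_gt0 chi id.
  by split=> -[chiM chi0 /E].
pose sU : irrType F (Ucal K q h) := DecSocleType (regular_repr F (Ucal K q h)).
pose sL : irrType F (UL K h) := DecSocleType (regular_repr F (UL K h)).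
pose IU := [set i : sU | [forall z in ZU, irr_repr i z == (top_char psi z)%:M]].
pose IL := [set i : sL | [forall z in ZL, irr_repr i z == (top_char psi z)%:M]].
have IUP (i : sU) : reflect (G_psi psi (irr_repr i)) (i \in IU).
  rewrite inE; apply: (iffP forall_inP) => [E | /topU[_ E] z Zz].
    by apply/topU; split=> [|z Zz]; [exact: socle_irr | exact/eqP/E].
  exact/eqP/E.
have splitL : group_splitting_field F (UL K h) by apply: group_closure_closed_field.
have degL (i : sL) : irr_degree i = 1%N.
  by apply: irr_degree_abelian => //; apply: tw_group1_abelian.
have degU (i : sU) : {in ZU, forall z, irr_repr i z = (top_char psi z)%:M} ->
    irr_degree i = (q ^ (h - 1))%N.
  by move=> E; apply: (dimG _ (irr_repr i)); apply/topU; split=> //; exact: socle_irr.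
have cardIU : (#|IU| * #|K| = #|K| ^ (h - 1))%N.
  have := card_irr_over charF0 (top_central _ qD q_gt0)
    (top_charM N_gt0 psiA) (top_char_neq0 psiA) degU.
  rewrite card_top_group // card_tw_group // mulnCA -/IU.
  (* The squared degree is [#|K| ^ (h - 1)], half of the exponent in the group order, and it
     cancels. *)
  have -> : ((q ^ (h - 1)) ^ 2 = #|K| ^ (h - 1))%N by rewrite cardK -!expnM mulnC.
  have -> : (#|K| ^ (2 * (h - 1)) = #|K| ^ (h - 1) * #|K| ^ (h - 1))%N.
    by rewrite mul2n -addnn expnD.
  move/eqP.
  by rewrite eqn_pmul2l ?expn_gt0 ?K_gt0 // => /eqP.
have cardIL : (#|IL| * #|K| = #|K| ^ (h - 1))%N.
  have := card_irr_over charF0 (top_central _ oneD (ltn0Sn 0))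
    (top_charM m_gt0 psiA) (top_char_neq0 psiA) (fun i _ => degL i).
  by rewrite card_top_group // card_tw_group // exp1n mul1n.
have eqI : #|IL| = #|IU| by apply/eqP; rewrite -(eqn_pmul2r K_gt0) cardIL cardIU.
have [f f_inj fIL] := bijection_of_card (principal_comp sU) eqI.
pose is_irr (chi : {'GL_(h - 1).+1[K]} -> F) (i : sL) :=
  [forall x in UL K h, irr_repr i x == (chi x)%:M].
(* At most one component of [UL] acts through [chi]; it is sent along [f]. The regular
   representation is a dummy value for functions that no component affords. *)
pose Phi chi : {n : nat & mx_representation F (Ucal K q h) n} :=
  if [pick i | is_irr chi i] is Some i then existT _ _ (irr_repr (f i))
  else existT _ _ (regular_repr F (Ucal K q h)).
have is_irrP chi (i : sL) :
    reflect {in UL K h, forall x, irr_repr i x = (chi x)%:M} (is_irr chi i).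
  by apply: (iffP forall_inP) => E x Lx; apply/eqP/E.
have is_irr_inj chi (i j : sL) : is_irr chi i -> is_irr chi j -> i = j.
  move=> /is_irrP Ei /is_irrP Ej; apply: (irr_rsim_inj charF0).
  exact: mx_rsim_linear Ei Ej.
have PhiE chi (i : sL) : is_irr chi i -> Phi chi = existT _ _ (irr_repr (f i)).
  move=> irr_i; rewrite /Phi; case: pickP => [j irr_j | /(_ i)]; last by rewrite irr_i.
  by rewrite (is_irr_inj _ _ _ irr_j irr_i).
have ex_irr chi : A_psi h psi chi -> exists2 i : sL, i \in IL & is_irr chi i.
  case/topL=> chiM chi0 chiZ.
  have [i iE] := linear_irr_exists charF0 sL chiM chi0.
  exists i; last exact/is_irrP.
  rewrite inE; apply/forall_inP => z Zz; rewrite -chiZ // iE //.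
  by case/twfamP: Zz.
have irr_mode_inj (chi1 chi2 : {'GL_(h - 1).+1[K]} -> F) (i : sL) :
    is_irr chi1 i -> is_irr chi2 i -> {in UL K h, chi1 =1 chi2}.
  move=> /is_irrP E1 /is_irrP E2 x Lx; have := E1 x Lx; rewrite E2 //.
  pose i0 := Ordinal (irr_degree_gt0 i).
  by move/matrixP/(_ i0 i0); rewrite !mxE eqxx !mulr1n.
exists Phi; split=> [chi /ex_irr[i ILi irr_i] | chi1 chi2 A1 _ e12 | chi1 chi2 | n rG rG_psi].
- by rewrite (PhiE chi i) //; apply/IUP; rewrite -fIL imset_f.
- have [i _ irr1] := ex_irr _ A1.
  have irr2 : is_irr chi2 i by apply/is_irrP => x Lx; rewrite -e12 //; apply/is_irrP.
  by rewrite (PhiE chi1 i) // (PhiE chi2 i) //; apply: mx_rsim_refl.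
- move=> /ex_irr[i ILi irr_i] /ex_irr[j ILj irr_j].
  rewrite (PhiE chi1 i) // (PhiE chi2 j) //= => /(irr_rsim_inj charF0)/f_inj ij.
  by apply: (irr_mode_inj _ _ i irr_i); rewrite ij.
have /topU[irrG topG] := rG_psi.
have rsimG := rsim_irr_comp_pchar sU (pchar0_pgroup charF0 _) irrG.
(* Surjectivity: the component isomorphic to [rG] lies in [IU], hence is [f i] for some [i] in [IL].
   As [UL] is abelian, it acts on [i] by the scalars [irr_mode i], which is the required
   character. *)
have : irr_comp sU rG \in IU.
  apply/IUP/topU; split=> [|z Zz]; first exact: socle_irr.
  have Gz : z \in Ucal K q h by case/twfamP: Zz.
  exact: mx_rsim_scalar Gz rsimG (topG z Zz).
rewrite -fIL => /imsetP[i ILi fi].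
have cL : abelian (UL K h) by apply: tw_group1_abelian.
have centL x : x \in UL K h -> x \in 'Z(UL K h) by rewrite (center_idP cL).
have irr_i : is_irr (irr_mode i) i.
  by apply/is_irrP => x Lx; rewrite (irr_center_scalar splitL) ?centL.
exists (irr_mode i).
  apply/topL; split=> [x y Lx Ly | x Lx | z Zz].
  - by rewrite (irr_modeM splitL) ?centL.
  - by rewrite (irr_mode_neq0 splitL) ?centL.
  have Lz : z \in UL K h by case/twfamP: Zz.
  move: ILi; rewrite inE => /forall_inP/(_ z Zz)/eqP.
  rewrite (is_irrP _ _ irr_i) //; pose i0 := Ordinal (irr_degree_gt0 i).
  by move/matrixP/(_ i0 i0); rewrite !mxE eqxx !mulr1n.
by rewrite (PhiE _ i irr_i) /= -fi; apply: mx_rsim_sym.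
Qed.
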